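(* Let $(\mathcal{C},\mathbb{E},\mathfrak{s})$ be an extriangulated category with enough projectives and enough injectives, and let $(\mathcal{X},\mathcal{W})$ be a strong left Frobenius pair in $\mathcal{C}$. If $n$ is a non-negative integer, then the following statements are equivalent: (1) $\widehat{\mathcal{X}_n}=\mathcal{C}$. (2) $\mathcal{P}=((\mathcal{W},\mathcal{C}),(\mathcal{X},\widehat{\mathcal{W}_n}))$ is an admissible model structure on $\mathcal{C}$.
   Context: Extriangulated categories (Nakaoka–Palu). Let $\mathcal{C}$ be an additive category and $\mathbb{E}:\mathcal{C}^{\mathrm{op}}\times\mathcal{C}\to\mathrm{Ab}$ an additive bifunctor. An element $\delta\in\mathbb{E}(C,A)$ is an $\mathbb{E}$-extension; write $a_*\delta=\mathbb{E}(C,a)(\delta)$ and $c^*\delta=\mathbb{E}(c,A)(\delta)$. Two sequences $A\to B\to C$ and $A\to B'\to C$ are equivalent if there is an isomorphism $B\to B'$ compatible with $\mathrm{id}_A,\mathrm{id}_C$. A realization $\mathfrak{s}$ assigns to each $\delta\in\mathbb{E}(C,A)$ an equivalence class $\mathfrak{s}(\delta)=[A\xrightarrow{x}B\xrightarrow{y}C]$ such that, if $\mathfrak{s}(\delta')=[A'\xrightarrow{x'}B'\xrightarrow{y'}C']$ and $a:A\to A'$, $c:C\to C'$ satisfy $a_*\delta=c^*\delta'$, then there is $b:B\to B'$ with $bx=x'a$, $y'b=cy$. It is additive if $\mathfrak{s}(0)$ is the class of the split sequence $A\to A\oplus C\to C$ and $\mathfrak{s}(\delta\oplus\delta')=\mathfrak{s}(\delta)\oplus\mathfrak{s}(\delta')$.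 The triple $(\mathcal{C},\mathbb{E},\mathfrak{s})$ is extriangulated if $\mathfrak{s}$ is an additive realization and the following hold. (ET3): if $\delta,\delta'$ are realized by $A\xrightarrow{x}B\xrightarrow{y}C$ and $A'\xrightarrow{x'}B'\xrightarrow{y'}C'$ and $bx=x'a$, then there is $c$ with $cy=y'b$ and $a_*\delta=c^*\delta'$. (ET3)$^{\mathrm{op}}$: the dual. (ET4): if $\delta\in\mathbb{E}(D,A)$ and $\delta'\in\mathbb{E}(F,B)$ are realized by $A\xrightarrow{f}B\xrightarrow{f'}D$ and $B\xrightarrow{g}C\xrightarrow{g'}F$, then there are an object $E$, morphisms $h':C\to E$, $d:D\to E$, $e:E\to F$ with $h'g=df'$, $eh'=g'$, and $\delta''\in\mathbb{E}(E,A)$ realized by $A\xrightarrow{gf}C\xrightarrow{h'}E$, such that $D\xrightarrow{d}E\xrightarrow{e}F$ realizes $f'_*\delta'$, $d^*\delta''=\delta$ and $f_*\delta''=e^*\delta'$. (ET4)$^{\mathrm{op}}$: the dual. A sequence $A\to B\to C$ realizing some $\delta$ is called a conflation; together with $\delta$ it is an $\mathbb{E}$-triangle; $A\to B$ is then an inflation and $B\to C$ a deflation. An object $P$ is projective if for every $\mathbb{E}$-triangle $A\to B\xrightarrow{y}C$ every morphism $P\to C$ factors through $y$; injective objects are dual. $\mathcal{C}$ has enough projectives (injectives) if every $C$ (every $A$) admits an $\mathbb{E}$-triangle $\Omega C\to P\to C$ with $P$ projective (resp. $A\to I\to\Sigma A$ with $I$ injective). Higher extensions: $\mathbb{E}^{i+1}(X,Y)=\mathbb{E}(\Omega^iX,Y)\cong\mathbb{E}(X,\Sigma^iY)$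 for $i\ge0$. ''Subcategory'' means full additive subcategory closed under isomorphisms and direct summands. $\mathcal{X}^{\perp}=\{Y\in\mathcal{C}\mid\mathbb{E}^i(X,Y)=0\ \forall i\ge1,\ \forall X\in\mathcal{X}\}$; dually ${}^{\perp}\mathcal{X}=\{Y\in\mathcal{C}\mid\mathbb{E}^i(Y,X)=0\ \forall i\ge1,\ \forall X\in\mathcal{X}\}$. $\widehat{\mathcal{X}_n}$ is the class of $C\in\mathcal{C}$ admitting an $\mathbb{E}$-triangle sequence $X_n\to\cdots\to X_0\to C$ with all $X_i\in\mathcal{X}$, i.e. there are $\mathbb{E}$-triangles $K_{i+1}\to X_i\to K_i$ ($0\le i\le n-1$) with $K_0=C$, $K_n=X_n$, the maps of the sequence being the induced composites (for $n=0$: $C\in\mathcal{X}$). $\widehat{\mathcal{W}_n}$ is defined in the same way from $\mathcal{W}$. A pair of subcategories $(\mathcal{X},\mathcal{W})$ is a left Frobenius pair in $\mathcal{C}$ if: $\mathcal{X}$ is closed under extensions (for an $\mathbb{E}$-triangle $A\to B\to C$, $A,C\in\mathcal{X}$ implies $B\in\mathcal{X}$) and under CoCone of deflations ($B,C\in\mathcal{X}$ implies $A\in\mathcal{X}$); and $\mathcal{W}$ is an $\mathcal{X}$-injective cogenerator for $\mathcal{X}$, i.e. $\mathcal{W}\subseteq\mathcal{X}$, $\mathcal{W}\subseteq\mathcal{X}^{\perp}$, and each $X\in\mathcal{X}$ admits an $\mathbb{E}$-triangle $X\to W\to X'$ with $W\in\mathcal{W}$, $X'\in\mathcal{X}$.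 It is strong if in addition $\mathcal{W}$ is an $\mathcal{X}$-projective generator for $\mathcal{X}$: $\mathcal{W}\subseteq{}^{\perp}\mathcal{X}$ and each $X\in\mathcal{X}$ admits an $\mathbb{E}$-triangle $X'\to W\to X$ with $W\in\mathcal{W}$, $X'\in\mathcal{X}$. A cotorsion pair on an extriangulated category $\mathcal{D}$ is a pair $(\mathcal{U},\mathcal{V})$ of full additive subcategories of $\mathcal{D}$ closed under isomorphisms and direct summands such that $\mathbb{E}(U,V)=0$ for all $U\in\mathcal{U},V\in\mathcal{V}$, and each $C\in\mathcal{D}$ admits conflations $V^C\to U^C\to C$ and $C\to V_C\to U_C$ in $\mathcal{D}$ with $U^C,U_C\in\mathcal{U}$ and $V^C,V_C\in\mathcal{V}$. For subcategories $\mathcal{A},\mathcal{B}$ of $\mathcal{D}$: $\mathrm{Cone}(\mathcal{A},\mathcal{B})$ consists of the objects $C$ admitting a conflation $A\to B\to C$, and $\mathrm{CoCone}(\mathcal{A},\mathcal{B})$ of the objects $C$ admitting a conflation $C\to A\to B$, with $A\in\mathcal{A}$, $B\in\mathcal{B}$. A Hovey twin cotorsion pair on $\mathcal{D}$ is a pair $((\mathcal{S},\mathcal{T}),(\mathcal{U},\mathcal{V}))$ of cotorsion pairs on $\mathcal{D}$ with $\mathbb{E}(\mathcal{S},\mathcal{V})=0$ and $\mathrm{Cone}(\mathcal{V},\mathcal{S})=\mathrm{CoCone}(\mathcal{V},\mathcal{S})$. Convention: ''admissible model structure on $\mathcal{D}$'' means a Hovey twin cotorsion pair on $\mathcal{D}$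 (the two correspond by a result of Nakaoka and Palu). *)

(* Defs.v *)
From HB Require Import structures.
From mathcomp Require Import all_boot all_order all_algebra.
From mathcomp Require Import boolp classical_sets.

Set Implicit Arguments.
Unset Strict Implicit.
Unset Printing Implicit Defensive.

Import GRing.Theory.
Local Open Scope classical_set_scope.
Local Open Scope ring_scope.

Reserved Notation "g \c f" (at level 40, left associativity).

Record additiveCategory := AdditiveCategory {
  obj :> Type;
  hom : obj -> obj -> zmodType;
  idm : forall A, hom A A;
  mcomp : forall A B C, hom B C -> hom A B -> hom A C;
  mcompA : forall A B C D (h : hom C D) (g : hom B C) (f : hom A B),
    mcomp h (mcomp g f) = mcomp (mcomp h g) f;
  mcomp1m : forall A B (f : hom A B), mcomp (idm B) f = f;
  mcompm1 : forall A B (f : hom A B), mcomp f (idm A) = f;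
  mcompDl : forall A B C (g g' : hom B C) (f : hom A B),
    mcomp (g + g') f = mcomp g f + mcomp g' f;
  mcompDr : forall A B C (g : hom B C) (f f' : hom A B),
    mcomp g (f + f') = mcomp g f + mcomp g f';
  zero_obj : obj;
  zero_initial : forall A (f : hom zero_obj A), f = 0;
  zero_terminal : forall A (f : hom A zero_obj), f = 0;
  biprod : obj -> obj -> obj;
  inj1 : forall A B, hom A (biprod A B);
  inj2 : forall A B, hom B (biprod A B);
  prj1 : forall A B, hom (biprod A B) A;
  prj2 : forall A B, hom (biprod A B) B;
  prj1_inj1 : forall A B, mcomp (prj1 A B) (inj1 A B) = idm A;
  prj2_inj2 : forall A B, mcomp (prj2 A B) (inj2 A B) = idm B;
  prj1_inj2 : forall A B, mcomp (prj1 A B) (inj2 A B) = 0;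
  prj2_inj1 : forall A B, mcomp (prj2 A B) (inj1 A B) = 0;
  biprod_id : forall A B,
    mcomp (inj1 A B) (prj1 A B) + mcomp (inj2 A B) (prj2 A B) =
    idm (biprod A B)
}.

Arguments hom {a} A B.
Arguments idm {a} A.
Arguments zero_obj {a}.
Arguments biprod {a} A B.
Arguments inj1 {a} A B.
Arguments inj2 {a} A B.
Arguments prj1 {a} A B.
Arguments prj2 {a} A B.

Notation "g \c f" := (mcomp g f) : ring_scope.

Definition is_iso (C : additiveCategory) (A B : C) (f : hom A B) : Prop :=
  exists g : hom B A, g \c f = idm A /\ f \c g = idm B.

Definition isomorphic (C : additiveCategory) (A B : C) : Prop :=
  exists f : hom A B, is_iso f.

Definition mor_biprod (C : additiveCategory) (A A' B B' : C)
    (f : hom A B) (f' : hom A' B') : hom (biprod A A') (biprod B B') :=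
  inj1 B B' \c f \c prj1 A A' + inj2 B B' \c f' \c prj2 A A'.

(* [bif E C A] is E(C, A): contravariant in C, covariant in A. *)
Record biadditiveFunctor (C : additiveCategory) := BiadditiveFunctor {
  bif :> C -> C -> zmodType;
  push : forall X A A' : C, hom A A' -> bif X A -> bif X A';
  pull : forall X' X A : C, hom X' X -> bif X A -> bif X' A;
  push_id : forall X A (d : bif X A), push (idm A) d = d;
  push_comp : forall X A A' A'' (a' : hom A' A'') (a : hom A A') (d : bif X A),
    push (a' \c a) d = push a' (push a d);
  pull_id : forall X A (d : bif X A), pull (idm X) d = d;
  pull_comp : forall X'' X' X A (c : hom X' X) (c' : hom X'' X') (d : bif X A),
    pull (c \c c') d = pull c' (pull c d);
  push_pull : forall X' X A A' (c : hom X' X) (a : hom A A') (d : bif X A),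
    push a (pull c d) = pull c (push a d);
  pushD : forall X A A' (a : hom A A') (d d' : bif X A),
    push a (d + d') = push a d + push a d';
  pullD : forall X' X A (c : hom X' X) (d d' : bif X A),
    pull c (d + d') = pull c d + pull c d';
  push_addm : forall X A A' (a a' : hom A A') (d : bif X A),
    push (a + a') d = push a d + push a' d;
  pull_addm : forall X' X A (c c' : hom X' X) (d : bif X A),
    pull (c + c') d = pull c d + pull c' d
}.

Definition ext_biprod (C : additiveCategory) (E : biadditiveFunctor C)
    (X A X' A' : C) (d : E X A) (d' : E X' A') :
    E (biprod X X') (biprod A A') :=
  push (inj1 A A') (pull (prj1 X X') d) +
  push (inj2 A A') (pull (prj2 X X') d').

Definition seq_equiv (C : additiveCategory) (A B B' X : C)
    (x : hom A B) (y : hom B X) (x' : hom A B') (y' : hom B' X) : Prop :=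
  exists b : hom B B', [/\ is_iso b, b \c x = x' & y' \c b = y].

(* The equivalence class s(d) is encoded by its membership predicate:
   [realizes d x y] means that s(d) is the class of A -x-> B -y-> X;
   the first two laws say that the predicate is exactly one class. *)
Record realization (C : additiveCategory) (E : biadditiveFunctor C) :=
  Realization {
  realizes : forall A B X : C, E X A -> hom A B -> hom B X -> Prop;
  realizes_ex : forall (A X : C) (d : E X A),
    exists (B : C) (x : hom A B) (y : hom B X), realizes d x y;
  realizes_class : forall (A B B' X : C) (d : E X A)
      (x : hom A B) (y : hom B X) (x' : hom A B') (y' : hom B' X),
    realizes d x y -> (realizes d x' y' <-> seq_equiv x y x' y');
  realizes_mor : forall (A B X A' B' X' : C) (d : E X A) (d' : E X' A')
      (x : hom A B) (y : hom B X) (x' : hom A' B') (y' : hom B' X')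
      (a : hom A A') (c : hom X X'),
    realizes d x y -> realizes d' x' y' -> push a d = pull c d' ->
    exists b : hom B B', b \c x = x' \c a /\ y' \c b = c \c y
}.

Section Conditions.
Variables (C : additiveCategory) (E : biadditiveFunctor C).
Variable s : realization E.

Definition additive_realization : Prop :=
  (forall A X : C, realizes s (0 : E X A) (inj1 A X) (prj2 A X)) /\
  (forall (A B X A' B' X' : C) (d : E X A) (d' : E X' A')
      (x : hom A B) (y : hom B X) (x' : hom A' B') (y' : hom B' X'),
    realizes s d x y -> realizes s d' x' y' ->
    realizes s (ext_biprod d d') (mor_biprod x x') (mor_biprod y y')).

Definition ET3 : Prop :=
  forall (A B X A' B' X' : C) (d : E X A) (d' : E X' A')
    (x : hom A B) (y : hom B X) (x' : hom A' B') (y' : hom B' X')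
    (a : hom A A') (b : hom B B'),
  realizes s d x y -> realizes s d' x' y' -> b \c x = x' \c a ->
  exists c : hom X X', c \c y = y' \c b /\ push a d = pull c d'.

Definition ET3op : Prop :=
  forall (A B X A' B' X' : C) (d : E X A) (d' : E X' A')
    (x : hom A B) (y : hom B X) (x' : hom A' B') (y' : hom B' X')
    (b : hom B B') (c : hom X X'),
  realizes s d x y -> realizes s d' x' y' -> c \c y = y' \c b ->
  exists a : hom A A', b \c x = x' \c a /\ push a d = pull c d'.

Definition ET4 : Prop :=
  forall (A B D Y F : C) (d1 : E D A) (d2 : E F B)
    (f : hom A B) (f' : hom B D) (g : hom B Y) (g' : hom Y F),
  realizes s d1 f f' -> realizes s d2 g g' ->
  exists (Z : C) (h' : hom Y Z) (d : hom D Z) (e : hom Z F) (d3 : E Z A),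
    [/\ h' \c g = d \c f' /\ e \c h' = g',
        realizes s d3 (g \c f) h',
        realizes s (push f' d2) d e,
        pull d d3 = d1
      & push f d3 = pull e d2].

Definition ET4op : Prop :=
  forall (A B D Y F : C) (d1 : E A D) (d2 : E B F)
    (f' : hom D B) (f : hom B A) (g' : hom F Y) (g : hom Y B),
  realizes s d1 f' f -> realizes s d2 g' g ->
  exists (Z : C) (h' : hom Z Y) (d : hom Z D) (e : hom F Z) (d3 : E A Z),
    [/\ g \c h' = f' \c d /\ h' \c e = g',
        realizes s d3 h' (f \c g),
        realizes s (pull f' d2) e d,
        push d d3 = d1
      & pull f d3 = push e d2].

End Conditions.

Record extriangulatedCategory := ExtriangulatedCategory {
  ecat :> additiveCategory;
  ext : biadditiveFunctor ecat;
  real : realization ext;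
  real_additive : additive_realization real;
  real_ET3 : ET3 real;
  real_ET3op : ET3op real;
  real_ET4 : ET4 real;
  real_ET4op : ET4op real
}.

Arguments ext {e}.
Arguments real {e}.

Section Notions.
Variable C : extriangulatedCategory.

Definition conflation (A B X : C) (x : hom A B) (y : hom B X) : Prop :=
  exists d : ext X A, realizes real d x y.

Definition projective (P : C) : Prop :=
  forall (A B X : C) (x : hom A B) (y : hom B X), conflation x y ->
  forall f : hom P X, exists g : hom P B, y \c g = f.

Definition injective_obj (I : C) : Prop :=
  forall (A B X : C) (x : hom A B) (y : hom B X), conflation x y ->
  forall f : hom A I, exists g : hom B I, g \c x = f.

(* Syzygies and cosyzygies are part of the data because the higher extension
   groups are defined from a choice of them. *)
Record enough_projectives := EnoughProjectives {
  Omega : C -> C;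
  Omega_conflation : forall X : C,
    exists (P : C) (x : hom (Omega X) P) (y : hom P X),
      projective P /\ conflation x y
}.

Record enough_injectives := EnoughInjectives {
  Sigma : C -> C;
  Sigma_conflation : forall A : C,
    exists (I : C) (x : hom A I) (y : hom I (Sigma A)),
      injective_obj I /\ conflation x y
}.

(* E^i(X, Y) for i >= 1; the value at i = 0 is meaningless. *)
Definition higher_ext (P : enough_projectives) (i : nat) (X Y : C) : zmodType :=
  ext (iter i.-1 (Omega P) X) Y.

Definition right_perp (P : enough_projectives) (X : set C) : set C :=
  [set B | forall i, (1 <= i)%N -> forall A, X A ->
     forall d : higher_ext P i A B, d = 0].

Definition left_perp (P : enough_projectives) (X : set C) : set C :=
  [set B | forall i, (1 <= i)%N -> forall A, X A ->
     forall d : higher_ext P i B A, d = 0].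

Record subcategory (X : set C) : Prop := Subcategory {
  subcat_zero : X zero_obj;
  subcat_biprod : forall A B, X A -> X B -> X (biprod A B);
  subcat_iso : forall A B, isomorphic A B -> X A -> X B;
  subcat_summand : forall A B, X (biprod A B) -> X A /\ X B
}.

(* The class of objects with an X-resolution of length n: the K i are the
   successive syzygies and Xs i the terms of the resolution. *)
Definition hat (X : set C) (n : nat) : set C :=
  [set M | exists K Xs : nat -> C,
    [/\ K 0%N = M,
        K n = Xs n,
        (forall i, (i <= n)%N -> X (Xs i))
      & forall i, (i < n)%N ->
          exists (x : hom (K i.+1) (Xs i)) (y : hom (Xs i) (K i)),
            conflation x y]].

Definition ext_closed (X : set C) : Prop :=
  forall (A B D : C) (x : hom A B) (y : hom B D),
  conflation x y -> X A -> X D -> X B.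

Definition cocone_closed (X : set C) : Prop :=
  forall (A B D : C) (x : hom A B) (y : hom B D),
  conflation x y -> X B -> X D -> X A.

Record injective_cogenerator (P : enough_projectives) (X W : set C) : Prop :=
  InjectiveCogenerator {
  icogen_sub : W `<=` X;
  icogen_perp : W `<=` right_perp P X;
  icogen_conflation : forall A, X A ->
    exists (B A' : C) (x : hom A B) (y : hom B A'),
      [/\ conflation x y, W B & X A']
}.

Record projective_generator (P : enough_projectives) (X W : set C) : Prop :=
  ProjectiveGenerator {
  pgen_sub : W `<=` X;
  pgen_perp : W `<=` left_perp P X;
  pgen_conflation : forall A, X A ->
    exists (A' B : C) (x : hom A' B) (y : hom B A),
      [/\ conflation x y, W B & X A']
}.

Record left_frobenius_pair (P : enough_projectives) (X W : set C) : Prop :=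
  LeftFrobeniusPair {
  lfrob_subcatX : subcategory X;
  lfrob_subcatW : subcategory W;
  lfrob_ext_closed : ext_closed X;
  lfrob_cocone_closed : cocone_closed X;
  lfrob_cogenerator : injective_cogenerator P X W
}.

Definition strong_left_frobenius_pair (P : enough_projectives)
    (X W : set C) : Prop :=
  left_frobenius_pair P X W /\ projective_generator P X W.

Definition ext_orthogonal (U V : set C) : Prop :=
  forall A B, U A -> V B -> forall d : ext A B, d = 0.

Record cotorsion_pair (U V : set C) : Prop := CotorsionPair {
  cotors_subcatU : subcategory U;
  cotors_subcatV : subcategory V;
  cotors_orth : ext_orthogonal U V;
  cotors_precover : forall M : C,
    exists (B A : C) (x : hom B A) (y : hom A M),
      [/\ conflation x y, U A & V B];
  cotors_preenvelope : forall M : C,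
    exists (B A : C) (x : hom M B) (y : hom B A),
      [/\ conflation x y, U A & V B]
}.

Definition Cone (X Y : set C) : set C :=
  [set M | exists (A B : C) (x : hom A B) (y : hom B M),
    [/\ conflation x y, X A & Y B]].

Definition CoCone (X Y : set C) : set C :=
  [set M | exists (A B : C) (x : hom M A) (y : hom A B),
    [/\ conflation x y, X A & Y B]].

Record hovey_twin_cotorsion_pair (ST UV : set C * set C) : Prop :=
  HoveyTwinCotorsionPair {
  hovey_ST : cotorsion_pair ST.1 ST.2;
  hovey_UV : cotorsion_pair UV.1 UV.2;
  hovey_orth : ext_orthogonal ST.1 UV.2;
  hovey_cone : Cone UV.2 ST.1 = CoCone UV.2 ST.1
}.

(* Admissible model structures are identified with Hovey twin cotorsion pairs
   (Nakaoka-Palu correspondence). *)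
Definition admissible_model_structure (P : (set C * set C) * (set C * set C)) :
    Prop :=
  hovey_twin_cotorsion_pair P.1 P.2.

End Notions.

(* Main.v *)
From mathcomp Require Import all_boot ssralg classical_sets.
Require Import Defs.

(** Everything rests on one identification. Write [orth X] for the objects [M]
    with E(A, M) = 0 for all A in X. If every object has an X-resolution of
    length n, then [hat W n = orth X] ([hatW_eq_orth]). One inclusion is
    dimension shifting: the groups E^i(A, -), i >= 1, vanish on W, hence on
    every object resolved by W. The other uses Auslander-Buchweitz
    approximations: every M in [hat X n] admits conflations V -> U -> M and
    M -> V' -> U' with U, U' in X and V, V' resolved by W
    ([hatX_precover], [hatX_preenvelope]), built by induction on n, one kind
    from the other. If M is in [orth X], so is the U of the first conflation,
    as an extension of M by V; the conflation U -> B -> U'' given by the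
    cogenerator W then splits, U is a summand of B and lies in W, and
    V -> U -> M turns a W-resolution of V into one of M.

    From resolutions to the model structure: the approximations and the
    identification with [orth X], which is visibly closed under summands, make
    (X, hat W n) a cotorsion pair. Dimension shifting with W left orthogonal
    to X shows that E(W, -) = 0 on all of C, and the projectives all lie in W
    because they are summands, first of an object of X and then of an object
    of W; so (W, C) is a cotorsion pair. Finally [Cone (hat W n) W] and
    [CoCone (hat W n) W] are both [orth X] ([Cone_hatW], [CoCone_hatW]).

    From the model structure to resolutions: in a conflation M -> V -> U with
    U in X and V resolved by W, take the deflation B -> V that begins the
    resolution of V. The cocone of the composite B -> U lies in X and maps
    onto M with the same kernel as B -> V, so M has an X-resolution of the
    same length as V ([hatX_cocone]). *)

Set Implicit Arguments.
Unset Strict Implicit.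
Unset Printing Implicit Defensive.

Local Open Scope classical_set_scope.

(** * Additive categories and biadditive functors *)

Section AdditiveCategory.
Import GRing.Theory.
Local Open Scope ring_scope.
Variable C : additiveCategory.

Lemma mcompm0 (A B D : C) (g : hom B D) : g \c (0 : hom A B) = 0.
Proof. by apply: (addrI (g \c (0 : hom A B))); rewrite -mcompDr !addr0. Qed.

Lemma mcomp0m (A B D : C) (f : hom A B) : (0 : hom B D) \c f = 0.
Proof. by apply: (addrI ((0 : hom B D) \c f)); rewrite -mcompDl !addr0. Qed.

Lemma mcompNl (A B D : C) (g : hom B D) (f : hom A B) : (- g) \c f = - (g \c f).
Proof. by apply: (addIr (g \c f)); rewrite -mcompDl !addNr mcomp0m. Qed.

Lemma mcompNr (A B D : C) (g : hom B D) (f : hom A B) : g \c (- f) = - (g \c f).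
Proof. by apply: (addIr (g \c f)); rewrite -mcompDr !addNr mcompm0. Qed.

(** If v = u - 1 satisfies v v = 0, then 1 - v inverts u = 1 + v. *)
Lemma is_iso_sqr0 (B : C) (u : hom B B) :
  (u - idm B) \c (u - idm B) = 0 -> is_iso u.
Proof.
move=> vv0; have -> : u = idm B + (u - idm B) by rewrite addrC subrK.
move: (u - idm B) vv0 => v vv0; exists (idm B - v).
split; rewrite mcompDl !mcompDr !(mcompNl, mcompNr, mcomp1m, mcompm1) vv0
  ?subr0 ?oppr0 ?addr0 ?subrK ?addrK //.
Qed.

Lemma is_iso_of_composites (B B' : C) (b : hom B B') (b' : hom B' B) :
  is_iso (b' \c b) -> is_iso (b \c b') -> is_iso b.
Proof.
move=> [r [r1 _]] [t [_ t1]].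
have lr : r \c b' = b' \c t.
  rewrite -[LHS]mcompm1 -t1 !mcompA -(mcompA r) r1 mcomp1m //.
by exists (b' \c t); rewrite -{1}lr -mcompA r1 mcompA t1.
Qed.

Lemma swap_is_iso (A B : C) :
  is_iso (inj2 A B \c prj1 B A + inj1 A B \c prj2 B A).
Proof.
exists (inj2 B A \c prj1 A B + inj1 B A \c prj2 A B).
by split; rewrite mcompDl !mcompDr !mcompA
  -!(mcompA _ (prj1 _ _)) -!(mcompA _ (prj2 _ _))
  ?prj1_inj1 ?prj2_inj2 ?prj1_inj2 ?prj2_inj1 !mcompm1 !mcompm0 !mcomp0m
  ?addr0 ?add0r ?biprod_id // addrC biprod_id.
Qed.

Variable E : biadditiveFunctor C.

Lemma pushr0 (Y A A' : C) (a : hom A A') : push a (0 : E Y A) = 0.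
Proof. by apply: (addrI (push a (0 : E Y A))); rewrite -pushD !addr0. Qed.

Lemma pullr0 (Y Y' A : C) (c : hom Y' Y) : pull c (0 : E Y A) = 0.
Proof. by apply: (addrI (pull c (0 : E Y A))); rewrite -pullD !addr0. Qed.

Lemma push0m (Y A A' : C) (d : E Y A) : push (0 : hom A A') d = 0.
Proof.
by apply: (addrI (push (0 : hom A A') d)); rewrite -push_addm !addr0.
Qed.

Lemma pull0m (Y Y' A : C) (d : E Y A) : pull (0 : hom Y' Y) d = 0.
Proof.
by apply: (addrI (pull (0 : hom Y' Y) d)); rewrite -pull_addm !addr0.
Qed.

End AdditiveCategory.

(** * Exactness and isomorphisms in extriangulated categories *)

Section Extriangulated.
Import GRing.Theory.
Local Open Scope ring_scope.
Variable C : extriangulatedCategory.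
Implicit Types (A B D M Z : C) (X W : set C).

Lemma realizes_split A D : realizes real (0 : ext D A) (inj1 A D) (prj2 A D).
Proof. by case: (real_additive C) => + _; apply. Qed.

(** The axioms give the split sequence in one order of the summands only; the
    swap of the biproduct carries it to the other. *)
Lemma realizes_split_swap A D :
  realizes real (0 : ext A D) (inj2 A D) (prj1 A D).
Proof.
apply/(realizes_class _ _ (realizes_split D A)).
exists (inj2 A D \c prj1 D A + inj1 A D \c prj2 D A).
split; first exact: swap_is_iso.
  by rewrite mcompDl -!mcompA prj1_inj1 prj2_inj1 mcompm0 mcompm1 addr0.
by rewrite mcompDr !mcompA prj1_inj2 prj1_inj1 mcomp0m mcomp1m add0r.
Qed.

Lemma realizes_isomorphic A B B' D (d : ext D A) (x : hom A B) (y : hom B D)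
    (x' : hom A B') (y' : hom B' D) :
  realizes real d x y -> realizes real d x' y' -> isomorphic B B'.
Proof.
by move=> r /(realizes_class x' y' r)[b [bi _ _]]; exists b.
Qed.

(** Exactness of Hom(Z, B) -> Hom(Z, D) -> E(Z, A) at the middle: f is compared
    with d by a morphism from the split extension of Z by A. *)
Lemma deflation_lift A B D Z (d : ext D A) (x : hom A B) (y : hom B D)
    (f : hom Z D) :
  realizes real d x y -> pull f d = 0 -> exists g : hom Z B, y \c g = f.
Proof.
move=> r fd0.
have [|b [_ yb]] := realizes_mor (a := idm A) (c := f) (realizes_split A Z) r.
  by rewrite push_id fd0.
by exists (b \c inj2 A Z); rewrite mcompA yb -mcompA prj2_inj2 mcompm1.
Qed.

(** Exactness of Hom(D, M) -> Hom(B, M) -> Hom(A, M) at the middle: a morphism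
    killing x is a map of conflations into 0 -> M -> M, to which (ET3)
    applies. *)
Lemma deflation_weak_cokernel A B D M (x : hom A B) (y : hom B D)
    (u : hom B M) :
  conflation x y -> u \c x = 0 -> exists v : hom D M, v \c y = u.
Proof.
move=> [d r] ux0.
have [|v [vy _]] := real_ET3 (a := 0) (b := inj2 zero_obj M \c u) r
  (realizes_split zero_obj M).
  by rewrite -mcompA ux0 !mcompm0.
by exists v; rewrite vy mcompA prj2_inj2 mcomp1m.
Qed.

(** The difference u - 1 kills x, hence factors through y, and y kills u - 1;
    so its square vanishes. *)
Lemma conflation_endo_is_iso A B D (x : hom A B) (y : hom B D) (u : hom B B) :
  conflation x y -> u \c x = x -> y \c u = y -> is_iso u.
Proof.
move=> xy ux yu; apply: is_iso_sqr0.
have [|v vy] := deflation_weak_cokernel (u := u - idm B) xy.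
  by rewrite mcompDl mcompNl mcomp1m ux subrr.
by rewrite -{1}vy -mcompA mcompDr mcompNr mcompm1 yu subrr mcompm0.
Qed.

(** Realizations are only given up to isomorphism of the middle term. To move
    the left end along an isomorphism, realize the pushed-out extension and
    compare it with the given sequence by morphisms in both directions, whose
    composites are invertible by [conflation_endo_is_iso]. *)
Lemma conflation_iso_left A A' B D (x : hom A B) (y : hom B D) (i : hom A' A) :
  conflation x y -> is_iso i -> conflation (x \c i) y.
Proof.
move=> [d r] [j [ji ij]].
have [B' [x' [y' r']]] := realizes_ex real (push j d).
have [|b [bx yb]] := realizes_mor (a := j) (c := idm D) r r'.
  by rewrite pull_id.
have [|b' [bx' yb']] := realizes_mor (a := i) (c := idm D) r' r.
  by rewrite -push_comp ij push_id pull_id.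
exists (push j d); apply/(realizes_class _ _ r'); exists b'.
rewrite mcomp1m in yb; rewrite mcomp1m in yb'.
split=> //; apply: (is_iso_of_composites (b' := b)).
  apply: (conflation_endo_is_iso (x := x') (y := y')); first by exists (push j d).
    by rewrite -mcompA bx' mcompA bx -mcompA ji mcompm1.
  by rewrite mcompA yb yb'.
apply: (conflation_endo_is_iso (x := x) (y := y)); first by exists d.
  by rewrite -mcompA bx mcompA bx' -mcompA ij mcompm1.
by rewrite mcompA yb' yb.
Qed.

(** (ET4)^op with the pulled-back sequence prescribed: the axiom produces some
    realization of [pull f' d2], and the left end is then moved to the given
    one. *)
Lemma conflation_of_pull A B D F M Z (d1 : ext A D) (d2 : ext B F)
    (f' : hom D B) (f : hom B A) (g' : hom F M) (g : hom M B)
    (u : hom F Z) (v : hom Z D) :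
  realizes real d1 f' f -> realizes real d2 g' g ->
  realizes real (pull f' d2) u v ->
  exists (p : hom Z M) (q : hom M A), conflation p q.
Proof.
move=> r1 r2 r.
have [Z' [h' [w [e [d3 [_ r3 rZ' _ _]]]]]] := real_ET4op r1 r2.
have [b [bi _ _]] := (realizes_class _ _ r).1 rZ'.
by exists (h' \c b), (f \c g); apply: conflation_iso_left bi; exists d3.
Qed.

(** The pushout of two inflations with the same source. Realize the sum of the
    two extensions over the biproduct of D1 and D2: its restriction to either
    summand is the given extension, so (ET4)^op along the two split sequences
    of the biproduct gives the two conflations, with the same M. *)
Lemma common_left_square A B1 B2 D1 D2 (x1 : hom A B1) (y1 : hom B1 D1)
    (x2 : hom A B2) (y2 : hom B2 D2) :
  conflation x1 y1 -> conflation x2 y2 ->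
  exists (M : C) (p1 : hom B1 M) (q2 : hom M D2)
    (p2 : hom B2 M) (q1 : hom M D1), conflation p1 q2 /\ conflation p2 q1.
Proof.
move=> [d1 r1] [d2 r2].
pose d := pull (prj1 D1 D2) d1 + pull (prj2 D1 D2) d2.
have dinj1 : pull (inj1 D1 D2) d = d1.
  by rewrite pullD -!pull_comp prj1_inj1 prj2_inj1 pull_id pull0m addr0.
have dinj2 : pull (inj2 D1 D2) d = d2.
  by rewrite pullD -!pull_comp prj1_inj2 prj2_inj2 pull_id pull0m add0r.
have [M [x [y r]]] := realizes_ex real d.
rewrite -{}dinj1 in r1; rewrite -{}dinj2 in r2.
have [p1 [q2 c1]] := conflation_of_pull (realizes_split D1 D2) r r1.
have [p2 [q1 c2]] := conflation_of_pull (realizes_split_swap D1 D2) r r2.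
by exists M, p1, q2, p2, q1.
Qed.

(** * Vanishing of extensions *)

Lemma conflation_id_zero M : conflation (inj1 M zero_obj) (prj2 M zero_obj).
Proof. by exists 0; apply: realizes_split. Qed.

Lemma conflation_zero_id M : conflation (inj1 zero_obj M) (prj2 zero_obj M).
Proof. by exists 0; apply: realizes_split. Qed.

Lemma ext0_retract Z A B (i : hom A B) (r : hom B A) : r \c i = idm A ->
  (forall d : ext Z B, d = 0) -> forall d : ext Z A, d = 0.
Proof. by move=> ri B0 d; rewrite -(push_id d) -ri push_comp (B0 (push i d)) pushr0. Qed.

(** Exactness of E(Z, A) -> E(Z, B) -> E(Z, D) at the middle. For an extension
    d2 of Z by B, (ET4) gives an object F which is an extension of Z by D,
    split by hypothesis, and d3 whose push-out to B is the pull-back of d2 to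
    F. A section of F -> Z exhibits d2 as a push-out from E(Z, A). *)
Lemma ext0_middle Z A B D (x : hom A B) (y : hom B D) : conflation x y ->
  (forall d : ext Z A, d = 0) -> (forall d : ext Z D, d = 0) ->
  forall d : ext Z B, d = 0.
Proof.
move=> [d1 r1] A0 D0 d2.
have [Y [g [g' r2]]] := realizes_ex real d2.
have [F [h' [w [e [d3 [_ _ re _ xd3]]]]]] := real_ET4 r1 r2.
rewrite (D0 (push y d2)) in re.
have [|m em] := deflation_lift (f := idm Z) re; first by rewrite pullr0.
by rewrite -(pull_id d2) -em pull_comp -xd3 -push_pull (A0 (pull m d3)) pushr0.
Qed.

(** E(Z, A) is a quotient of Hom(K, A), where K is a syzygy of Z. *)
Lemma proj_ext_push (P K Z A : C) (w : ext Z K) (x : hom K P) (y : hom P Z)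
    (d : ext Z A) :
  projective P -> realizes real w x y -> exists f : hom K A, push f w = d.
Proof.
move=> projP r; have [B [g [g' r']]] := realizes_ex real d.
have [|b yb] := projP _ _ _ g g' _ y; first by exists d.
have [|f [_ fw]] := real_ET3op (b := b) (c := idm Z) r r'.
  by rewrite mcomp1m yb.
by exists f; rewrite fw pull_id.
Qed.

(** The identity of P lifts through y, and the pull-back of d along y vanishes
    because (ET3)^op maps a split extension to it. *)
Lemma proj_ext0 (P A : C) (d : ext P A) : projective P -> d = 0.
Proof.
move=> projP; have [B [x [y r]]] := realizes_ex real d.
have [|g yg] := projP _ _ _ x y _ (idm P); first by exists d.
have [|f [_ fd]] :=
  real_ET3op (b := prj2 A B) (c := y) (realizes_split A B) r.
  by [].
rewrite pushr0 in fd.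
by rewrite -(pull_id d) -yg pull_comp -fd pullr0.
Qed.

(** Dimension shifting: an extension of Z by D comes from a map from the syzygy
    of Z to D; this map lifts to B since E(Omega Z, A) = 0, so the extension is
    a push-out from E(Z, B) = 0. *)
Lemma ext0_shift (P : enough_projectives C) Z A B D (x : hom A B)
    (y : hom B D) : conflation x y ->
  (forall d : ext (Omega P Z) A, d = 0) -> (forall d : ext Z B, d = 0) ->
  forall d : ext Z D, d = 0.
Proof.
move=> [e r] A0 B0 d.
have [Q [u [v [projQ [w rw]]]]] := Omega_conflation P Z.
have [f <-] := proj_ext_push d projQ rw.
have [g <-] := deflation_lift (f := f) r (A0 _).
by rewrite push_comp (B0 (push g w)) pushr0.
Qed.

Lemma subcategory_split X A B D (x : hom A B) (y : hom B D) :
  subcategory X -> realizes real 0 x y -> X B -> X A /\ X D.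
Proof.
move=> sX r XB; apply: (subcat_summand sX).
by apply: (subcat_iso sX) XB; apply: realizes_isomorphic r (realizes_split A D).
Qed.

(** * Resolutions and orthogonality *)

Lemma hat0P X M : hat X 0 M <-> X M.
Proof.
split; first by move=> [K [Xs [<- -> /(_ 0%N (leqnn _))]]].
by move=> XM; exists (fun=> M), (fun=> M).
Qed.

Lemma hatSP X n M : hat X n.+1 M <->
  exists (K B : C) (x : hom K B) (y : hom B M),
    [/\ conflation x y, X B & hat X n K].
Proof.
split.
  move=> [K [Xs [K0 Kn XXs cfl]]]; have [x [y xy]] := cfl 0%N isT.
  rewrite -K0; exists (K 1%N), (Xs 0%N), x, y; split=> //; first exact: XXs.
  exists (K \o S), (Xs \o S); split=> // i lin; first exact: XXs.
  exact: cfl.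
move=> [K0 [B [x [y [xy XB [K [Xs [KK0 Kn XXs cfl]]]]]]]].
rewrite -{}KK0 in x xy.
exists (fun i => if i is j.+1 then K j else M),
  (fun i => if i is j.+1 then Xs j else B); split=> // -[|i] // lin.
- exact: XXs.
- by exists x, y.
- exact: cfl.
Qed.

(** Only E^1 is required to vanish, unlike in [right_perp]: this makes the
    stability properties immediate. For a left Frobenius pair the two agree on
    [hat X n], by [orth_hatW] and [hatW_right_perp]. *)
Definition orth X : set C :=
  [set M | forall A, X A -> forall d : ext A M, d = 0].

Lemma orth_middle X A B D (x : hom A B) (y : hom B D) :
  conflation x y -> orth X A -> orth X D -> orth X B.
Proof.
by move=> xy oA oD Z XZ; apply: (ext0_middle xy); [apply: oA | apply: oD].
Qed.

Lemma orth_subcategory X : subcategory (orth X).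
Proof.
split.
- by move=> A XA d; rewrite -(push_id d) [idm _]zero_initial push0m.
- move=> A B oA oB Z XZ d.
  rewrite -(push_id d) -biprod_id push_addm !push_comp.
  by rewrite (oA _ XZ (push _ d)) (oB _ XZ (push _ d)) !pushr0 addr0.
- move=> A B [f [g [_ fg]]] oA Z XZ.
  by apply: (ext0_retract fg); apply: oA.
- move=> A B oAB; split=> Z XZ.
    by apply: (ext0_retract (prj1_inj1 A B)); apply: oAB.
  by apply: (ext0_retract (prj2_inj2 A B)); apply: oAB.
Qed.

Lemma right_perpP (P : enough_projectives C) X M :
  right_perp P X M <-> forall j A, X A -> forall d : ext (iter j (Omega P) A) M, d = 0.
Proof.
split=> [h j A XA | h [|i] // _ A XA d]; first exact: (h j.+1 isT A XA).
exact: (h i A XA).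
Qed.

Lemma left_perpP (P : enough_projectives C) X M :
  left_perp P X M <-> forall j A, X A -> forall d : ext (iter j (Omega P) M) A, d = 0.
Proof.
split=> [h j A XA | h [|i] // _ A XA d]; first exact: (h j.+1 isT A XA).
exact: (h i A XA).
Qed.

(** Dimension shifting along the resolution raises the degree, so the induction
    has to carry all the higher groups. *)
Lemma hat_syzygy_ext0 (P : enough_projectives C) X Z n M :
  (forall j A, X A -> forall d : ext (iter j (Omega P) Z) A, d = 0) ->
  hat X n M -> forall j, forall d : ext (iter j (Omega P) Z) M, d = 0.
Proof.
move=> X0; elim: n M => [|n IH] M; first by move=> /hat0P XM j; apply: X0.
move=> /hatSP[K [B [x [y [xy XB hK]]]]] j.
by apply: (ext0_shift (P := P) xy); [apply: (IH K hK j.+1) | apply: X0].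
Qed.

(** * Approximations for a left Frobenius pair *)

Section FrobeniusPair.
Variables (P : enough_projectives C) (X W : set C).
Hypothesis XW : left_frobenius_pair P X W.

Let sX : subcategory X := lfrob_subcatX XW.
Let sW : subcategory W := lfrob_subcatW XW.
Let WX : W `<=` X := icogen_sub (lfrob_cogenerator XW).

Lemma hatW_right_perp n : hat W n `<=` right_perp P X.
Proof.
move=> M hM; apply/right_perpP => j A XA; apply: (hat_syzygy_ext0 _ hM) => i B WB.
by move/right_perpP: (icogen_perp (lfrob_cogenerator XW) WB); apply.
Qed.

Lemma hatW_orth n : hat W n `<=` orth X.
Proof. by move=> M /hatW_right_perp /right_perpP /(_ 0%N). Qed.

Lemma hatW_sub_hatX M n : hat W n M -> hat X n M.
Proof.
move=> [K [Xs [K0 Kn WXs cfl]]]; exists K, Xs; split=> // i /WXs; exact: WX.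
Qed.

(** The conflation M -> B -> D given by the cogenerator splits, so M is a
    summand of B. *)
Lemma X_orth_W M : X M -> orth X M -> W M.
Proof.
move=> /(icogen_conflation (lfrob_cogenerator XW))[B [D [x [y [[d r] WB XD]]]]] oM.
by rewrite (oM _ XD d) in r; case: (subcategory_split sW r WB).
Qed.

Definition has_precover n M := exists (V U : C) (x : hom V U) (y : hom U M),
  [/\ conflation x y, X U & hat W n V].

Definition has_preenvelope n M := exists (V U : C) (x : hom M V) (y : hom V U),
  [/\ conflation x y, X U & hat W n V].

(** Embed U into B in W with cokernel in X. By (ET4) the composite V -> B is an
    inflation; its cokernel Z is one step longer to resolve than V, and M embeds
    into Z with the cokernel of U -> B. *)
Lemma precover_preenvelope n M : has_precover n M -> has_preenvelope n.+1 M.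
Proof.
move=> [V [U [x [y [[d1 r1] XU hV]]]]].
have [B [U' [g [g' [[d2 r2] WB XU']]]]] :=
  icogen_conflation (lfrob_cogenerator XW) XU.
have [Z [h' [w [e [d3 [_ r3 re _ _]]]]]] := real_ET4 r1 r2.
exists Z, U', w, e; split=> //; first by exists (push y d2).
by apply/hatSP; exists V, B, (g \c x), h'; split=> //; exists d3.
Qed.

(** Push K -> B out along K -> V: the pushout is an extension of U by B, hence
    lies in X, and maps onto M with kernel V. *)
Lemma preenvelope_precover n K B M (x : hom K B) (y : hom B M) :
  conflation x y -> X B -> has_preenvelope n K -> has_precover n M.
Proof.
move=> xy XB [V [U [i [j [ij XU hV]]]]].
have [L [p1 [q2 [p2 [q1 [pq1 pq2]]]]]] := common_left_square xy ij.
exists V, L, p2, q1; split=> //.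
exact: (lfrob_ext_closed XW pq1).
Qed.

Lemma hatX_preenvelope n M : hat X n M -> has_preenvelope n M.
Proof.
elim: n M => [|n IH] M.
  move=> /hat0P /(icogen_conflation (lfrob_cogenerator XW)).
  move=> [B [D [x [y [xy WB XD]]]]].
  by exists B, D, x, y; split=> //; apply/hat0P.
move=> /hatSP[K [B [x [y [xy XB hK]]]]].
by apply: precover_preenvelope; apply: (preenvelope_precover xy XB); apply: IH.
Qed.

(** The kernel has a W-resolution one step shorter than the X-resolution of M;
    for n = 0, where M itself lies in X, the kernel is zero. *)
Lemma hatX_precover n M : hat X n M -> has_precover n.-1 M.
Proof.
case: n => [/hat0P XM | n].
  exists zero_obj, (biprod zero_obj M), (inj1 _ _), (prj2 _ _).
  split; first exact: conflation_zero_id.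
    by apply: (subcat_biprod sX) => //; apply: (subcat_zero sX).
  by apply/hat0P/(subcat_zero sW).
move=> /hatSP[K [B [x [y [xy XB hK]]]]].
by apply: (preenvelope_precover xy XB); apply: hatX_preenvelope.
Qed.

Lemma precover_orth n M V U (x : hom V U) (y : hom U M) :
  conflation x y -> X U -> hat W n V -> orth X M -> W U.
Proof.
by move=> xy XU hV oM; apply: X_orth_W => //; apply: orth_middle xy _ oM;
  apply: hatW_orth hV.
Qed.

(** In the approximation V -> U -> M the term U is orthogonal to X as an
    extension of M by V, hence lies in W. *)
Lemma orth_hatW n M : hat X n M -> orth X M -> hat W n M.
Proof.
move=> hM oM; case: n hM => [/hat0P XM | n /hatX_precover].
  by apply/hat0P/X_orth_W.
move=> [V [U [x [y [xy XU hV]]]]]; apply/hatSP; exists V, U, x, y; split=> //.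
exact: precover_orth xy XU hV oM.
Qed.

(** Let K -> B -> V begin an X-resolution of V. The pull-back Z of B along
    M -> V is the cocone of the composite deflation B -> U, so it lies in X, and
    K -> Z -> M begins an X-resolution of M. *)
Lemma hatX_cocone n M V U (x : hom M V) (y : hom V U) :
  conflation x y -> X U -> hat X n V -> hat X n M.
Proof.
move=> xy XU; case: n => [/hat0P XV | n].
  by apply/hat0P; apply: (lfrob_cocone_closed XW xy).
move=> /hatSP[K [B [u [v [[d2 r2] XB hK]]]]].
have [d1 r1] := xy.
have [Z [h' [w [e [d3 [_ r3 re _ _]]]]]] := real_ET4op r1 r2.
apply/hatSP; exists K, Z, e, w; split=> //; first by exists (pull x d2).
by apply: (lfrob_cocone_closed XW (x := h') (y := y \c v)) => //; exists d3.
Qed.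

(** * The cotorsion pairs and the comparison of cones *)

Hypothesis XWgen : projective_generator P X W.

Lemma W_ext0 n M A : hat X n M -> W A -> forall d : ext A M, d = 0.
Proof.
move=> hM WA; apply: (hat_syzygy_ext0 (P := P) (j := 0%N) _ hM).
by apply/left_perpP; apply: (pgen_perp XWgen).
Qed.

(** A conflation ending in a projective splits: Q is a summand of the first term
    of its X-resolution, hence in X, and then of an object of W. *)
Lemma projective_W n Q : hat X n Q -> projective Q -> W Q.
Proof.
move=> hQ projQ.
have proj_summand S A B (x : hom A B) (y : hom B Q) :
    subcategory S -> conflation x y -> S B -> S Q.
  move=> sS [d r] SB; rewrite (proj_ext0 d projQ) in r.
  by have [] := subcategory_split sS r SB.
have XQ : X Q.
  case: n hQ => [/hat0P // | n /hatSP[K [B [x [y [xy XB _]]]]]].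
  exact: proj_summand sX xy XB.
have [K [B [x [y [xy WB _]]]]] := pgen_conflation XWgen XQ.
exact: proj_summand sW xy WB.
Qed.

Section FullResolution.
Variable n : nat.
Hypothesis hatXT : hat X n = [set: C].

Let hatXM M : hat X n M. Proof. by rewrite hatXT. Qed.

Lemma hatW_eq_orth : hat W n = orth X.
Proof.
apply/seteqP; split=> M; first exact: hatW_orth.
exact: orth_hatW.
Qed.

Lemma cotorsion_pair_WT : cotorsion_pair W [set: C].
Proof.
split=> //.
- by move=> A M WA _; apply: W_ext0 WA.
- move=> M; have [Q [x [y [projQ xy]]]] := Omega_conflation P M.
  exists (Omega P M), Q, x, y; split=> //.
  exact: projective_W projQ.
- move=> M; exists (biprod M zero_obj), zero_obj, (inj1 _ _), (prj2 _ _).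
  by split=> //; [apply: conflation_id_zero | apply: (subcat_zero sW)].
Qed.

Lemma cotorsion_pair_X_hatW : cotorsion_pair X (hat W n).
Proof.
split=> //.
- by rewrite hatW_eq_orth; apply: orth_subcategory.
- by move=> A M XA hM; apply: (hatW_orth hM).
- move=> M; have [V [U [x [y [xy XU hV]]]]] := hatX_precover (hatXM M).
  exists V, U, x, y; split=> //.
  by rewrite hatW_eq_orth; apply: hatW_orth hV.
- move=> M; have [V [U [x [y [xy XU hV]]]]] := hatX_preenvelope (hatXM M).
  by exists V, U, x, y.
Qed.

(** A cone of V -> U is in [orth X] by dimension shifting, as E^2(A, V) = 0.
    Conversely, the precover of an object of [orth X] has its middle term in
    W. *)
Lemma Cone_hatW : Cone (hat W n) W = orth X.
Proof.
apply/seteqP; split=> M.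
  move=> [V [U [x [y [xy hV WU]]]]] A XA.
  have /right_perpP oV := hatW_right_perp hV.
  apply: (ext0_shift (P := P) xy); first exact: (oV 1%N).
  by move/right_perpP: (icogen_perp (lfrob_cogenerator XW) WU) => /(_ 0%N); apply.
move=> oM; have [V [U [x [y [xy XU hV]]]]] := hatX_precover (hatXM M).
exists V, U, x, y; split=> //; last exact: precover_orth xy XU hV oM.
by rewrite hatW_eq_orth; apply: hatW_orth hV.
Qed.

(** Conflations ending in W split, so the cocones are summands of objects of
    [hat W n]. *)
Lemma CoCone_hatW : CoCone (hat W n) W = orth X.
Proof.
apply/seteqP; split=> M.
  move=> [V [U [x [y [[d r] hV WU]]]]].
  rewrite (W_ext0 (hatXM M) WU d) hatW_eq_orth in r hV.
  by have [] := subcategory_split (orth_subcategory X) r hV.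
move=> oM; exists (biprod M zero_obj), zero_obj, (inj1 _ _), (prj2 _ _).
split; [exact: conflation_id_zero | | exact: (subcat_zero sW)].
rewrite hatW_eq_orth; apply: (subcat_biprod (orth_subcategory X)) => //.
exact: (subcat_zero (orth_subcategory X)).
Qed.

End FullResolution.

Lemma hatX_full_of_cotorsion n : cotorsion_pair X (hat W n) ->
  hat X n = [set: C].
Proof.
move=> ct; apply/seteqP; split=> // M _.
have [V [U [x [y [xy XU hV]]]]] := cotors_preenvelope ct M.
exact: hatX_cocone xy XU (hatW_sub_hatX hV).
Qed.

End FrobeniusPair.
End Extriangulated.

Theorem theorem4p5 (C : extriangulatedCategory)
    (P : enough_projectives C) (I : enough_injectives C)
    (X W : set C) (n : nat) :
  strong_left_frobenius_pair P X W ->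
  (hat X n = [set: C] <->
   admissible_model_structure ((W, [set: C]), (X, hat W n))).
Proof.
move=> [XW XWgen]; split; last first.
  by move=> [_ ct _ _]; exact: (hatX_full_of_cotorsion XW ct).
move=> full; split=> /=.
- exact: (cotorsion_pair_WT XW XWgen full).
- exact: (cotorsion_pair_X_hatW XW full).
- move=> A M WA hM; apply: (hatW_orth XW hM).
  exact: (icogen_sub (lfrob_cogenerator XW)).
- by rewrite (Cone_hatW XW full) (CoCone_hatW XW XWgen full).
Qed.
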